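(* Let $p$ be a prime, let $n,k>0$ be integers and let $a\in\mathbb{F}_p^*$. If the polynomial $x^n(x^k+a)$ permutes $\mathbb{F}_p$, then $\gcd(k,p-1)\ge \sqrt{p-(3/4)}-(1/2) > \sqrt{p}-1$.
   Context: A polynomial $f\in\mathbb{F}_q[x]$ is said to permute $\mathbb{F}_q$ if the map $\alpha\mapsto f(\alpha)$ is a bijection $\mathbb{F}_q\to\mathbb{F}_q$. *)

(* Defs.v *)
From mathcomp Require Import all_boot all_order all_algebra.

Set Implicit Arguments.
Unset Strict Implicit.
Unset Printing Implicit Defensive.

Import GRing.Theory Num.Theory.
Local Open Scope ring_scope.

Definition permutes (F : finFieldType) (f : {poly F}) : Prop :=
  bijective (fun x : F => f.[x]).

(* Main.v *)
(** Let [g = gcd(k, p-1)] and [d = (p-1)/g]; the claim amounts to [d <= g + 1],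
    and in fact [d <= g].  If [g < d], let [m] be minimal such that some [c/m]
    lies in the interval [[n'/d, (n'+g)/d]], where [n'] is the quotient of [n]
    by [k/g] modulo [d].  Between two fractions [c/m < (c+1)/m] there is a
    fraction of denominator [m-1], so [c] is unique and [m < d].  Expanding
    [(x^n (x^k + a))^(g m)] and summing over [x] in [F_p], the only monomials
    with nonzero sum are those with exponent divisible by [p-1], and they
    correspond to these [c].  So this power sum is a single nonzero term, whereas
    for a permutation it equals the sum of all [x^(g m)], which is [0] as
    [0 < g m < p-1]. *)
Require Import Defs.
From mathcomp Require Import all_boot all_order all_algebra.
From mathcomp Require Import finfield zify ring lra.

Set Implicit Arguments.
Unset Strict Implicit.
Unset Printing Implicit Defensive.

Import Order.TTheory GRing.Theory Num.Theory.
Local Open Scope ring_scope.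

Lemma card_finRing_natr0 (R : finNzRingType) : #|R|%:R = 0 :> R.
Proof.
have : \sum_(x : R) x = \sum_(x : R) (1 + x) by exact: reindex_inj (addrI 1).
rewrite big_split /= sumr_const => /eqP.
by rewrite -subr_eq subrr eq_sym => /eqP.
Qed.

(** If [#|F|.-1] divides [e], every nonzero [x] contributes 1. Otherwise, substituting [b * x] for
    [x] multiplies the sum by [b ^+ e], which differs from 1 for a suitable [b]. *)
Lemma sum_exp_finField (F : finFieldType) (e : nat) : (0 < e)%N ->
  \sum_(x : F) x ^+ e = if (#|F|.-1 %| e)%N then -1 else 0.
Proof.
move=> e_gt0; have F_gt1 := finNzRing_gt1 F.
have expF (x : F) : x != 0 -> x ^+ #|F|.-1 = 1.
  by move=> x0; apply: (mulfI x0); rewrite -exprS prednK ?expf_card ?mulr1 // ltnW.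
case: ifPn => [/dvdnP[c ec] | ndvd].
  rewrite (bigD1 0) //= expr0n gtn_eqF // add0r.
  rewrite (eq_bigr (fun=> 1)); last first.
    by move=> x x0; rewrite ec mulnC exprM expF // expr1n.
  have := card_finRing_natr0 F; rewrite -sumr_const (bigD1 0) //=.
  by move/eqP; rewrite addrC addr_eq0 => /eqP.
set r := (e %% #|F|.-1)%N.
have r_gt0 : (0 < r)%N by rewrite lt0n.
have r_lt : (r < #|F|.-1)%N by rewrite ltn_mod -subn1 subn_gt0.
(* Otherwise all [#|F|.-1] nonzero elements would be [r]-th roots of unity, with [r < #|F|.-1]. *)
have [b b0 br] : exists2 b : F, b != 0 & b ^+ e != 1.
  have [/existsP[b /andP[]] | /existsPn all1] :=
    boolP [exists b : F, (b != 0) && (b ^+ e != 1)]; first by exists b.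
  suff : (#|predC1 (0%R : F)| <= r)%N by rewrite cardC1 leqNgt r_lt.
  rewrite cardE; apply: max_unity_roots (enum_uniq _) => //.
  apply/allP => b; rewrite mem_enum => b0.
  have := all1 b; rewrite (b0 : b != 0) negbK unity_rootE.
  by rewrite (divn_eq e #|F|.-1) exprD mulnC exprM expF // expr1n mul1r.
have : \sum_(x : F) x ^+ e = \sum_(x : F) (b * x) ^+ e.
  exact: reindex_inj (mulfI b0).
under [in RHS]eq_bigr do rewrite exprMn.
rewrite -mulr_sumr => /eqP; rewrite -subr_eq0 -[X in X - _]mul1r -mulrBl mulf_eq0.
by rewrite subr_eq0 eq_sym (negbTE br) => /eqP.
Qed.

Lemma permutes_sum_exp (F : finFieldType) (f : {poly F}) (i : nat) :
  permutes f -> (0 < i < #|F|.-1)%N -> \sum_(x : F) f.[x] ^+ i = 0.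
Proof.
move=> /bij_inj f_inj /andP[i_gt0 i_lt].
transitivity (\sum_(x : F) x ^+ i).
  by apply: esym; exact: reindex_inj f_inj.
rewrite sum_exp_finField //.
by rewrite gtnNdvd.
Qed.

(** Writing [c = q * m + r] with [r < m], the fraction [q + r / (m - 1)] lies between [c / m] and
    [(c + 1) / m]. *)
Lemma fraction_between_pred (n g d m c : nat) : (1 < m)%N ->
  (n * m <= c * d)%N -> (c.+1 * d <= (n + g) * m)%N ->
  exists c', (n * m.-1 <= c' * d <= (n + g) * m.-1)%N.
Proof.
case: m => // m m_gt0 lo hi; exists (c %/ m.+1 * m + c %% m.+1)%N.
rewrite [m.+1.-1]/=.
have := ltn_pmod c (ltn0Sn m); have := divn_eq c m.+1.
move: (c %/ _)%N (c %% _)%N => q r c_eq r_le; subst c.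
have lo' : ((q * m.+1 + r) * m <= (q * m + r) * m.+1)%N.
  by rewrite !mulnDl mulnAC leq_add2l leq_mul2l leqnSn orbT.
have hi' : ((q * m + r) * m.+1 <= (q * m.+1 + r).+1 * m)%N.
  rewrite -addnS !mulnDl mulnAC leq_add2l mulnS mulSn leq_add2r.
  by rewrite -ltnS.
apply/andP; split; rewrite -(leq_pmul2r (ltn0Sn m)) mulnAC.
  apply: leq_trans (leq_mul lo (leqnn m)) _.
  by rewrite mulnAC [leqRHS]mulnAC leq_mul2r lo' orbT.
rewrite [leqRHS]mulnAC; apply: leq_trans _ (leq_mul hi (leqnn m)).
by rewrite [leqRHS]mulnAC leq_mul2r hi' orbT.
Qed.

(** A multiple [c * d = n * m + j] with [j <= g * m] encodes a fraction [c / m] in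
    [[n / d, (n + g) / d]]. *)
Lemma unique_multiple_in_window (n g d : nat) : (0 < g < d)%N ->
  exists m j0 : nat, [/\ (0 < m < d)%N, (j0 <= g * m)%N
    & forall j, (j <= g * m)%N -> (d %| n * m + j)%N = (j == j0)].
Proof.
move=> /andP[g_gt0 g_lt]; have d_gt0 : (0 < d)%N by exact: leq_trans g_lt.
pose P m := (0 < m)%N && [exists j : 'I_(g * m).+1, (d %| n * m + j)%N].
have Pd : P d.
  apply/andP; split; first lia.
  by apply/existsP; exists ord0; rewrite addn0 dvdn_mull.
have [m /andP[m_gt0 /existsP[j0 dj0]] m_min] := ex_minnP (ex_intro _ d Pd).
have gap j1 j2 : (j1 < j2 <= g * m)%N -> (d %| n * m + j1)%N ->
    (d %| n * m + j2)%N -> False.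
  move=> /andP[lt12 le2] /dvdnP[c1 e1] /dvdnP[c2 e2].
  have c12 : (c1 < c2)%N.
    by rewrite -(ltn_pmul2r d_gt0) -e1 -e2 ltn_add2l.
  have hi : (c1.+1 * d <= (n + g) * m)%N.
    by apply: leq_trans (leq_mul c12 (leqnn d)) _; rewrite -e2 mulnDl leq_add2l.
  (* For [m = 1] the two multiples of [d] would differ by at most [g < d]. *)
  have m_gt1 : (1 < m)%N.
    by rewrite ltn_neqAle m_gt0 andbT; apply/eqP => m1; move: hi le2;
      rewrite mulSn -e1 -m1; lia.
  have lo : (n * m <= c1 * d)%N by rewrite -e1 leq_addr.
  have [c' /andP[lo' hi']] := fraction_between_pred m_gt1 lo hi.
  have : P m.-1.
    apply/andP; split; first lia.
    have jlt : (c' * d - n * m.-1 < (g * m.-1).+1)%N by rewrite mulnDl in hi'; lia.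
    by apply/existsP; exists (Ordinal jlt); rewrite /= subnKC // dvdn_mull.
  by move=> /m_min; lia.
have j0_le : (j0 <= g * m)%N by rewrite -ltnS.
exists m, j0; split=> // [|j j_le].
  (* If [m = d], both [j = 0] and [j = d] would give multiples. *)
  rewrite m_gt0 ltn_neqAle m_min // andbT; apply/eqP => md.
  apply: (gap 0%N d); rewrite md ?dvdn_add ?dvdn_mull ?dvdn0 //.
  by rewrite d_gt0 leq_pmull.
apply/idP/eqP => [dj | -> //].
case: (ltngtP j j0) => // lt_j; exfalso.
  by apply: (gap j j0) => //; rewrite lt_j.
by apply: (gap j0 j) => //; rewrite lt_j.
Qed.

(** Take [n' = u * n] with [u] an inverse of [k] modulo [d]; multiplying by [u] or by [k] passes
    between the two conditions. *)
Lemma coprime_dvdn_normalize (n k d : nat) : (0 < k)%N -> coprime k d ->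
  exists n', forall m j, (d %| n * m + k * j)%N = (d %| n' * m + j)%N.
Proof.
move=> k_gt0 co_kd; case: (egcdnP d k_gt0) => u v uv _.
rewrite (eqP co_kd) in uv.
exists (u * n)%N => m j; apply/idP/idP => dvd.
  have := dvdn_mull u dvd.
  have -> : (u * (n * m + k * j) = u * n * m + j + v * j * d)%N.
    by rewrite mulnDr [(u * (k * j))%N]mulnA uv; ring.
  by rewrite dvdn_addl // dvdn_mull.
have := dvdn_mull k dvd.
have -> : (k * (u * n * m + j) = n * m + k * j + v * n * m * d)%N.
  by rewrite mulnDr !mulnA [(k * u)%N]mulnC uv; ring.
by rewrite dvdn_addl // dvdn_mull.
Qed.

(** Positivity of [n] and [i] keeps every exponent of [x] positive, so each power sum is -1 or 0. *)
Lemma sum_exp_binomial (F : finFieldType) (n k i : nat) (a : F) :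
  (0 < n)%N -> (0 < i)%N ->
  \sum_(x : F) ('X^n * ('X^k + a%:P)).[x] ^+ i =
  - \sum_(j < i.+1 | (#|F|.-1 %| n * i + k * j)%N) a ^+ (i - j) *+ 'C(i, j).
Proof.
move=> n_gt0 i_gt0.
have expand (x : F) : ('X^n * ('X^k + a%:P)).[x] ^+ i =
    \sum_(j < i.+1) x ^+ (n * i + k * j) * (a ^+ (i - j) *+ 'C(i, j)).
  rewrite !hornerE exprMn -exprM addrC exprDn mulr_sumr.
  apply: eq_bigr => j _; rewrite exprD -!exprM !mulrnAr.
  by rewrite -mulrA [a ^+ _ * _]mulrC.
under eq_bigr do rewrite expand.
rewrite exchange_big /= -sumrN [RHS]big_mkcond; apply: eq_bigr => j _.
rewrite -mulr_suml sum_exp_finField ?addn_gt0 ?muln_gt0 ?n_gt0 ?i_gt0 //.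
by case: ifP; rewrite ?mulN1r ?mul0r.
Qed.

Lemma prime_ndvd_fact (p n : nat) : prime p -> (n < p)%N -> ~~ (p %| n`!)%N.
Proof.
move=> p_prime; elim: n => [|n IHn] n_lt; first by rewrite Euclid_dvd1.
by rewrite factS Euclid_dvdM // negb_or IHn ?gtnNdvd // ltnW.
Qed.

Lemma permutes_binomial_gcdn (p n k : nat) (a : 'F_p) :
  prime p -> (0 < n)%N -> (0 < k)%N -> a != 0 ->
  permutes ('X^n * ('X^k + a%:P)) ->
  (p.-1 <= gcdn k p.-1 * gcdn k p.-1)%N.
Proof.
move=> p_prime n_gt0 k_gt0 a_neq0 f_perm.
have cardF := card_Fp p_prime.
set g := gcdn k p.-1.
have g_gt0 : (0 < g)%N by rewrite gcdn_gt0 k_gt0.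
have [d pd] : exists d, p.-1 = (d * g)%N by apply/dvdnP/dvdn_gcdr.
have [k' kk'] : exists k', k = (k' * g)%N by apply/dvdnP/dvdn_gcdl.
have co_kd : coprime k' d.
  by rewrite /coprime -(eqn_pmul2r g_gt0) muln_gcdl -kk' -pd mul1n.
have k'_gt0 : (0 < k')%N by lia.
rewrite pd leq_pmul2r // leqNgt; apply/negP => g_lt.
have [n' n'E] := coprime_dvdn_normalize n k'_gt0 co_kd.
have [|m [j0 [/andP[m_gt0 m_lt] j0_le j0P]]] := @unique_multiple_in_window n' g d.
  by rewrite g_gt0.
have i_gt0 : (0 < g * m)%N by rewrite muln_gt0 g_gt0.
have i_lt : (g * m < p.-1)%N by rewrite pd mulnC ltn_pmul2r.
have := permutes_sum_exp f_perm (i := (g * m)%N).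
rewrite cardF i_gt0 i_lt => /(_ isT)/eqP.
rewrite sum_exp_binomial // oppr_eq0 cardF.
have j0_lt : (j0 < (g * m).+1)%N by [].
rewrite (big_pred1 (Ordinal j0_lt)) => [|j]; last first.
  rewrite /= -val_eqE /= -j0P; last by rewrite -ltnS.
  rewrite -n'E pd [in (k * _)%N]kk'.
  rewrite (_ : n * (g * m) + k' * g * j = (n * m + k' * j) * g)%N; last by ring.
  by rewrite dvdn_pmul2r.
rewrite -mulr_natr mulf_eq0 expf_eq0 (negbTE a_neq0) andbF /=.
(* The surviving binomial coefficient divides [(g * m)!], which is prime to [p] since
   [g * m < p]. *)
have : ~~ (p %| 'C(g * m, j0))%N.
  apply/negP => dvd; have : (p %| (g * m)`!)%N.
    by rewrite -(bin_fact j0_le) dvdn_mulr.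
  by apply/negP/prime_ndvd_fact => //; exact: leq_trans i_lt (leq_pred p).
by rewrite (dvdn_pcharf (pchar_Fp p_prime)) => /negbTE ->.
Qed.

Theorem theorem2p1 (R : rcfType) (p n k : nat) (a : 'F_p)
    (p_prime : prime p) (n_gt0 : (0 < n)%N) (k_gt0 : (0 < k)%N)
    (a_neq0 : a != 0)
    (f_perm : permutes ('X^n * ('X^k + a%:P))) :
  Num.sqrt (p%:R - 3 / 4) - 1 / 2 <= (gcdn k (p - 1))%:R :> R /\
  Num.sqrt p%:R - 1 < Num.sqrt (p%:R - 3 / 4) - 1 / 2 :> R.
Proof.
have := permutes_binomial_gcdn p_prime n_gt0 k_gt0 a_neq0 f_perm.
rewrite subn1; set g := gcdn _ _ => g_ge.
have p_gt1 := prime_gt1 p_prime.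
(* This says that [p - 3/4] is at most the square of [g + 1/2]. *)
have p_le : (p <= g * g + g + 1)%N by lia.
have pR_le : (p%:R <= g%:R * g%:R + g%:R + 1 :> R).
  by rewrite -natrM -natrD -(natrD _ _ 1) ler_nat.
have pR_gt1 : (1 < p%:R :> R) by rewrite ltr1n.
have g_ge0 : (0 <= g%:R :> R) by rewrite ler0n.
split.
  rewrite lerBlDr -ler_sqr ?nnegrE ?sqrtr_ge0 ?addr_ge0 //; last lra.
  rewrite sqr_sqrtr; last lra.
  rewrite sqrrD; lra.
have s_gt1 : 1 < Num.sqrt p%:R :> R by rewrite -[ltLHS]sqrtr1 ltr_sqrt //; lra.
have s2 : Num.sqrt p%:R ^+ 2 = p%:R :> R by rewrite sqr_sqrtr; lra.
(* After squaring, this reduces to [1 < Num.sqrt p%:R]. *)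
have : Num.sqrt p%:R - 1 / 2 < Num.sqrt (p%:R - 3 / 4) :> R.
  by rewrite -ltr_sqr ?nnegrE ?sqrtr_ge0 ?sqr_sqrtr; nra.
lra.
Qed.
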